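(* Let $G\cong C_{n_1}\oplus\cdots\oplus C_{n_r}$ be a finite abelian group, where $1<n_1\mid n_2\mid\cdots\mid n_r$, and let $k$ be a positive integer with $k\le |G|-1$. Then $|\mathsf N(G,k)|=|\mathsf N(G,|G|-k)|$ if and only if at least one of the following conditions holds: (1) $|G|$ is odd; (2) $r\ge 2$ and $2\mid n_{r-1}$; (3) $v_2(k)<v_2(n_r)$.
   Context: Groups are written additively and $C_n$ denotes the cyclic group of order $n$. For a positive integer $j\le |G|$, $\mathsf N(G,j)$ is the set of all subsets $S\subseteq G$ of cardinality $j$ whose sum of elements $\sum_{g\in S}g$ equals $0$. For a positive integer $m$, $v_2(m)$ denotes the 2-adic valuation of $m$. *)

(* Defs.v *)
From HB Require Import structures.
From mathcomp Require Import all_boot all_order all_fingroup all_algebra.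

Set Implicit Arguments.
Unset Strict Implicit.
Unset Printing Implicit Defensive.

Definition zero_sum_subsets (G : finZmodType) (j : nat) : {set {set G}} :=
  [set S : {set G} | (#|S| == j) && ((\sum_(g in S) g)%R == 0%R :> G)].

(* The moduli are n 1, ..., n r; other values of n are irrelevant.  The group
   law of the product is componentwise addition, and since 'Z_m is the ring of
   integers modulo m only for 1 < m, this type is only meaningful when
   1 < n i for 1 <= i <= r. *)
Definition cyclic_sum (r : nat) (n : nat -> nat) : finGroupType :=
  {dffun forall i : 'I_r, 'Z_(n i.+1)}.

(* Main.v *)
Require Import Defs.
From HB Require Import structures.
From mathcomp Require Import all_boot all_order all_fingroup all_algebra.
From mathcomp Require Import gproduct cyclic pgroup abelian.

(** Complementation turns the zero-sum subsets of size |G| - k into the subsets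
    of size k whose sum is sigma, the sum of all elements of G. If |G| is odd
    or the Sylow 2-subgroup of G is not cyclic, then sigma = 0. Otherwise let w,
    of order q = 2 ^ (a + 1), generate the Sylow 2-subgroup; sigma is its
    involution u = 2 ^ a w. If q does not divide k, then k v = u for some v, and
    translating by v exchanges the sums 0 and u.

    Suppose k = m q. A set S that is not a union of cosets of <w> meets some
    coset in j elements with 0 < j < q; translating that part of S by some v in
    <w> with j v = u exchanges the sums 0 and u, so these S contribute equally to
    both counts. If S is a union of m cosets, its sum is m u plus an element of
    odd order, so of the two values only m u can occur, and it does occur for a
    set S with S = - S. *)

Set Implicit Arguments.
Unset Strict Implicit.
Unset Printing Implicit Defensive.

Import GRing.Theory FinRing.Theory.
Local Open Scope ring_scope.

(** * Subsets of prescribed size and sum, under complement and translation *)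

Definition subsets_sum (G : finZmodType) (k : nat) (s : G) : {set {set G}} :=
  [set S : {set G} | (#|S| == k) && (\sum_(g in S) g == s)].

Lemma in_subsets_sum (G : finZmodType) (k : nat) (s : G) (S : {set G}) :
  (S \in subsets_sum k s) = (#|S| == k) && (\sum_(g in S) g == s).
Proof. by rewrite inE. Qed.

Lemma card_subsets_sumC (G : finZmodType) (k : nat) (s : G) : (k <= #|G|)%N ->
  #|subsets_sum (#|G| - k) s| = #|subsets_sum k (\sum_g g - s)|.
Proof.
move=> lekG; rewrite -(card_imset _ (@setC_inj G)); apply: eq_card => S.
have sumC (B : {set G}) : \sum_(g in ~: B) g = \sum_g g - \sum_(g in B) g.
  rewrite [X in _ = X - _](bigID [in B]) /= addrAC subrr add0r.
  by apply: eq_bigl => g; rewrite inE.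
apply/imsetP/idP => [[B /[!in_subsets_sum] /andP[/eqP cB /eqP sB] ->]|].
  by rewrite cardsCs setCK cB subKn // eqxx sumC sB /=.
rewrite in_subsets_sum => /andP[/eqP cS /eqP sS].
exists (~: S); last by rewrite setCK.
by rewrite in_subsets_sum cardsCs setCK cS sumC sS opprB addrC addrNK !eqxx.
Qed.

(** Translation by [v] is injective and adds [v] once for each element. An inequality is enough:
    when [v *+ k] is an involution, a second application leads back to [s]. *)
Lemma leq_subsets_sum_shift (G : finZmodType) (k : nat) (s v : G) :
  (#|subsets_sum k s| <= #|subsets_sum k (s + v *+ k)%R|)%N.
Proof.
have injv : injective (+%R^~ v) by apply: addIr.
rewrite -(card_imset _ (imset_inj injv)); apply: subset_leq_card.
apply/subsetP => _ /imsetP[B /[!in_subsets_sum] /andP[/eqP <- /eqP <-] ->].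
rewrite card_imset // eqxx big_imset /=; last by move=> x y _ _ /injv.
by rewrite big_split sumr_const.
Qed.

(** * Cosets of a subgroup and their unions *)

Definition block (G : finZmodType) (P : {group G}) (x : G) : {set G} :=
  [set y | y - x \in P].

Definition stable (G : finZmodType) (P : {group G}) (S : {set G}) :=
  forall x y : G, x \in S -> y \in P -> x + y \in S.

Lemma in_block (G : finZmodType) (P : {group G}) (x y : G) :
  (y \in block P x) = (y - x \in P).
Proof. by rewrite inE. Qed.

Lemma block_image (G : finZmodType) (P : {group G}) (x : G) :
  block P x = +%R x @: P.
Proof.
apply/setP => y; rewrite in_block; apply/idP/imsetP => [Py | [z Pz ->]].
  by exists (y - x) => //; rewrite addrC addrNK.
by rewrite addrC addKr.
Qed.

Lemma card_block (G : finZmodType) (P : {group G}) (x : G) :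
  #|block P x| = #|P|.
Proof. by rewrite block_image card_imset //; apply: addrI. Qed.

Lemma sum_block (G : finZmodType) (P : {group G}) (x : G) :
  \sum_(y in block P x) y = x *+ #|P| + \sum_(y in P) y.
Proof.
rewrite block_image big_imset /=; last by move=> y z _ _ /addrI.
by rewrite big_split sumr_const.
Qed.

Lemma mem_block (G : finZmodType) (P : {group G}) (x : G) : x \in block P x.
Proof. by rewrite in_block subrr -zmod1gE group1. Qed.

Lemma groupD (G : finZmodType) (P : {group G}) (x y : G) :
  x \in P -> (x + y \in P) = (y \in P).
Proof. by rewrite -zmodMgE => /groupMl ->. Qed.

Lemma groupDr (G : finZmodType) (P : {group G}) (x y : G) :
  x \in P -> (y + x \in P) = (y \in P).
Proof. by rewrite -zmodMgE => /groupMr ->. Qed.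

Lemma groupN (G : finZmodType) (P : {group G}) (x : G) :
  (- x \in P) = (x \in P).
Proof. by rewrite -zmodVgE groupV. Qed.

Lemma stable_block (G : finZmodType) (P : {group G}) (x : G) :
  stable P (block P x).
Proof. by move=> y z /[!in_block] Py Pz; rewrite addrAC groupDr. Qed.

Lemma stable_sub_block (G : finZmodType) (P : {group G}) (S : {set G}) x y :
  stable P S -> y \in S -> y \in block P x -> block P x \subset S.
Proof.
move=> stS Sy; rewrite in_block => Py.
apply/subsetP => z; rewrite in_block => Pz.
have -> : z = y + ((z - x) - (y - x)).
  by rewrite opprB subrKA addrC subrK.
by rewrite stS // groupDr ?groupN.
Qed.

Lemma stableD (G : finZmodType) (P : {group G}) (S T : {set G}) :
  stable P S -> stable P T -> stable P (S :\: T).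
Proof.
move=> stS stT x y /[!in_setD] /andP[nTx Sx] Py; rewrite stS // andbT.
apply: contra nTx => Txy; rewrite -(addrK y x) stT //.
by rewrite groupN.
Qed.

(** Whole cosets are removed one at a time: [m] counts them and [Y] is the sum of their chosen
    representatives. *)
Lemma sum_stable (G : finZmodType) (P : {group G}) (S : {set G}) :
  stable P S -> exists Y m, #|S| = (m * #|P|)%N /\
    \sum_(x in S) x = Y *+ #|P| + (\sum_(y in P) y) *+ m.
Proof.
have [c] := ubnP #|S|; elim: c S => // c IHc S ltSc stS.
have [-> | [x Sx]] := set_0Vmem S.
  by exists 0, 0%N; rewrite cards0 big_set0 mul0n mul0rn mulr0n add0r.
have sBS := stable_sub_block stS Sx (mem_block P x).
have cD : #|S :\: block P x| = (#|S| - #|P|)%N.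
  by rewrite cardsD (setIidPr sBS) card_block.
have lePS : (#|P| <= #|S|)%N by rewrite -(card_block P x) subset_leq_card.
have [||Y [m [cY sY]]] := IHc (S :\: block P x).
- by rewrite cD ltn_subLR // (leq_trans ltSc) // -add1n leq_add2r cardG_gt0.
- exact: stableD (@stable_block _ _ _).
exists (Y + x), m.+1; split.
  by rewrite mulSn -cY cD subnKC.
rewrite (big_setID (block P x)) /= (setIidPr sBS) sum_block sY mulrnDl mulrS.
by rewrite addrACA [_ + Y *+ _]addrC.
Qed.

(** * The sum over a cyclic subgroup *)

Lemma sum_cycle (G : finZmodType) (w : G) :
  \sum_(y in <[w]>%g) y = w *+ 'C(#[w]%g, 2).
Proof.
have -> : <[w]>%g = [set w *+ val i | i : 'I_#[w]%g].
  apply/setP => y; apply/idP/imsetP => [/cyclePmin[i lti ->] | [i _ ->]].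
    by exists (Ordinal lti).
  by rewrite -zmodXgE mem_cycle.
rewrite big_imset /=; last first.
  move=> i j _ _ /eqP; rewrite -!zmodXgE eq_expg_mod_order !modn_small //.
  by move/eqP/val_inj.
by rewrite -bin2_sum big_mkord sumrMnr.
Qed.

Lemma sum_cycle_even (G : finZmodType) (w : G) (h : nat) :
  #[w]%g = h.*2 -> \sum_(y in <[w]>%g) y = w *+ h.
Proof.
move=> ow; have wn : w *+ h.*2 = 0 by rewrite -ow -zmodXgE expg_order.
rewrite sum_cycle ow bin2; case: h {ow} wn => [|h] wn; first by rewrite mulr0n.
(* With [h] now a successor, the binomial coefficient is h(2h - 1) = h + 2h(h - 1), and 2h kills
   [w]. *)
rewrite -doubleMl doubleK doubleS succnK mulnS mulrnDr.
by rewrite -doubleMr doubleMl mulrnA wn mul0rn addr0.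
Qed.

(** * Sets with a partially filled coset *)

(** Stated through cardinalities alone, so that any map preserving the number of elements in each
    coset preserves the property. *)
Definition partial_block (G : finZmodType) (P : {group G}) (S : {set G})
  (x : G) := (0 < #|S :&: block P x| < #|P|)%N.

Definition unstable_sets (G : finZmodType) (P : {group G}) : {set {set G}} :=
  [set S | [exists x, partial_block P S x]].

Lemma unstable_setsPn (G : finZmodType) (P : {group G}) (S : {set G}) :
  reflect (stable P S) (S \notin unstable_sets P).
Proof.
rewrite inE negb_exists; apply: (iffP forallP) => [nS x y Sx Py | stS x].
  have := nS x; rewrite /partial_block negb_and -leqNgt -leqNgt leqn0.
  case/orP => [|le].
    rewrite cards_eq0 => /eqP/setP/(_ x).
    by rewrite in_setI Sx mem_block in_set0.
  have /eqP/setIidPr/subsetP sBS : S :&: block P x == block P x.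
    by rewrite eqEcard subsetIr card_block.
  by rewrite sBS // in_block addrC addKr.
rewrite /partial_block; have [-> | [y]] := set_0Vmem (S :&: block P x).
  by rewrite cards0.
rewrite in_setI => /andP[Sy By].
by rewrite (setIidPr (stable_sub_block stS Sy By)) card_block ltnn andbF.
Qed.

Definition shift_block (G : finZmodType) (P : {group G}) (x v y : G) : G :=
  if y \in block P x then y + v else y.

Lemma mem_shift_block (G : finZmodType) (P : {group G}) (x v y z : G) :
  v \in P -> (shift_block P x v y \in block P z) = (y \in block P z).
Proof.
rewrite /shift_block => Pv; case: ifP => _ //.
by rewrite !in_block addrAC (groupDr _ Pv).
Qed.

Lemma shift_blockK (G : finZmodType) (P : {group G}) (x v : G) :
  v \in P -> cancel (shift_block P x v) (shift_block P x (- v)).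
Proof.
move=> Pv y; rewrite [LHS]/shift_block mem_shift_block // /shift_block.
by case: (y \in block P x); rewrite ?addrK.
Qed.

(** As [v] lies in [P], the shift is injective and maps each coset of [P] into itself. *)
Lemma card_shift_block (G : finZmodType) (P : {group G}) (S : {set G})
    (x v z : G) : v \in P ->
  #|shift_block P x v @: S :&: block P z| = #|S :&: block P z|.
Proof.
move=> Pv; rewrite -(card_imset (S :&: _) (can_inj (shift_blockK x Pv))).
apply: eq_card => y; rewrite in_setI; apply/andP/imsetP.
  move=> [/imsetP[t St ->]]; rewrite mem_shift_block // => Bt.
  by exists t; rewrite // in_setI St.
move=> [t /[!in_setI] /andP[St Bt] ->].
by rewrite mem_shift_block // Bt imset_f.
Qed.

(* Translating the part of [S] in its first partially filled block preserves
   which blocks are partially filled, so that [twist] can be undone. *)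
Definition twist (G : finZmodType) (P : {group G}) (f : nat -> G)
    (S : {set G}) : {set G} :=
  if [pick x | partial_block P S x] is Some x
  then shift_block P x (f #|S :&: block P x|) @: S else S.

(** [twist] is an injection between the two families: it moves the [j] chosen elements of one coset
    by [f j], which adds [f j *+ j = u] to the sum. *)
Lemma leq_card_unstable (G : finZmodType) (P : {group G}) (k : nat) (s u : G)
    (f : nat -> G) :
  (forall j, (0 < j < #|P|)%N -> f j \in P /\ f j *+ j = u) ->
  (#|subsets_sum k s :&: unstable_sets P|
     <= #|subsets_sum k (s + u)%R :&: unstable_sets P|)%N.
Proof.
move=> fP.
have twistE S : S \in unstable_sets P -> exists x,
    [/\ [pick x | partial_block P S x] = Some x, partial_block P S x,
        twist P f S = shift_block P x (f #|S :&: block P x|) @: S,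
        f #|S :&: block P x| \in P
      & forall z, #|twist P f S :&: block P z| = #|S :&: block P z|].
  rewrite inE /twist => /existsP[x0 Sx0].
  case: pickP => [x Sx | /(_ x0)]; last by rewrite Sx0.
  have [Pf _] := fP _ Sx; exists x; split=> // z.
  exact: card_shift_block.
have twist_inj : {in unstable_sets P &, injective (twist P f)}.
  move=> S T /twistE[x [pS _ eS Px cS]] /twistE[y [pT _ eT Py cT]] eST.
  (* Equal images have equal counts in every coset, so both sets picked the same representative and
     were shifted by the same amount. *)
  have : Some x = Some y.
    by rewrite -pS -pT; apply: eq_pick => z; rewrite /partial_block -cS -cT eST.
  case=> exy; subst y; rewrite -cS in Px eS; rewrite -cT -eST in Py eT.
  exact: imset_inj (can_inj (shift_blockK x Px)) _ _ (etrans (esym eS) eT).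
rewrite -(card_in_imset (f := twist P f) (D := _ :&: _)); last first.
  by move=> S T /setIP[_ US] /setIP[_ UT]; apply: twist_inj.
apply: subset_leq_card; apply/subsetP => _ /imsetP[S /setIP[kS US] ->].
have [x [_ pbS eS Px cS]] := twistE S US.
rewrite inE; apply/andP; split; last first.
  by rewrite inE; apply/existsP; exists x; rewrite /partial_block cS.
have inj := can_inj (shift_blockK x Px).
move: kS; rewrite !in_subsets_sum => /andP[/eqP <- /eqP <-].
rewrite eS card_imset // eqxx big_imset /=; last by move=> y z _ _ /inj.
(* The sum splits into the part in the picked coset, which gains [u], and the rest, which is
   fixed. *)
apply/eqP; rewrite (big_setID (block P x)) /=.
rewrite [in RHS](big_setID (block P x)) /=.
have [_ <-] := fP _ pbS; rewrite addrAC -sumr_const -big_split /=.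
congr (_ + _); apply: eq_bigr => y; rewrite /shift_block.
  by rewrite in_setI => /andP[_ ->].
by rewrite in_setD => /andP[/negPf ->].
Qed.

(** * Symmetric unions of cosets *)

Lemma stableU (G : finZmodType) (P : {group G}) (S T : {set G}) :
  stable P S -> stable P T -> stable P (S :|: T).
Proof.
move=> stS stT x y /setUP[Sx | Tx] Py; apply/setUP; [left | right].
  exact: stS.
exact: stT.
Qed.

Lemma cardsU_block (G : finZmodType) (P : {group G}) (S : {set G}) (x : G) :
  stable P S -> x \notin S -> #|S :|: block P x| = (#|S| + #|P|)%N.
Proof.
move=> stS nSx; rewrite cardsU card_block.
have [-> | [y /setIP[Sy By]]] := set_0Vmem (S :&: block P x).
  by rewrite cards0 subn0.
have /subsetP/(_ _ (mem_block P x)) := stable_sub_block stS Sy By.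
by rewrite (negPf nSx).
Qed.

(** Starting from [P], pairs of opposite cosets are added. The hypothesis on doubling says that the
    quotient by [P] has no involution, so the two cosets of a pair differ. Keeping [P] inside [S]
    serves this step and later allows [P] to be removed. *)
Lemma exists_symmetric_stable (G : finZmodType) (P : {group G}) (j : nat) :
  (forall x : G, x + x \in P -> x \in P) -> (j.*2.+1 * #|P| <= #|G|)%N ->
  exists S : {set G}, [/\ stable P S, forall x, x \in S -> - x \in S,
    (P : {set G}) \subset S & #|S| = (j.*2.+1 * #|P|)%N].
Proof.
move=> P2; elim: j => [|j IHj] lejG.
  exists P; split; rewrite ?mul1n // => x; first by move=> y Px; rewrite groupD.
  by rewrite groupN.
have [|S [stS symS sPS cS]] := IHj.
  by apply: leq_trans lejG; rewrite leq_mul2r doubleS !ltnS !leqW ?orbT.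
have /set0Pn[x] : ~: S != set0.
  rewrite -card_gt0 cardsCs setCK subn_gt0 cS; apply: leq_trans lejG.
  by rewrite ltn_mul2r cardG_gt0 doubleS leqnSn.
rewrite in_setC => nSx.
have stSx := stableU stS (@stable_block _ P x).
exists (S :|: block P x :|: block P (- x)); split.
- exact: stableU stSx (@stable_block _ P (- x)).
- move=> y /setUP[/setUP[/symS Sy | ] | ].
  + by rewrite !in_setU Sy.
  + rewrite in_block -groupN opprD => By.
    by rewrite in_setU [X in _ || X]in_block By orbT.
  + rewrite in_block opprK -groupN opprD => By.
    by rewrite !in_setU [X in _ || X || _]in_block By orbT.
- by rewrite -setUA subsetU ?sPS.
rewrite !cardsU_block // ?cS ?doubleS ?mulSn.
  by rewrite -addnA addnC !addnA.
(* If [- x] were in the coset of [x], then [x + x], hence [x], would lie in [P] and so in [S]. *)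
rewrite in_setU negb_or in_block -opprD groupN; apply/andP; split.
  by apply: contra nSx => /symS; rewrite opprK.
by apply: contra nSx => /P2/(subsetP sPS).
Qed.

(** * Groups with a cyclic Sylow 2-subgroup *)

(** [<[w]>] is a normal Sylow 2-subgroup, so it contains every element of 2-power order, and [x] has
    such an order because its double does. *)
Lemma odd_index_cycle (G : finZmodType) (w : G) (a M : nat) :
  #[w]%g = (2 ^ a)%N -> #|G| = (2 ^ a * M)%N -> odd M ->
  forall x : G, x + x \in <[w]>%g -> x \in <[w]>%g.
Proof.
move=> ow cG oM x Px.
have hallP : (2.-Hall([set: G]) <[w]>)%g.
  rewrite pHallE subsetT cardsT cG -orderE ow partnM ?expn_gt0 ?(odd_gt0 oM) //.
  rewrite part_pnat_id ?pnatX ?pnat_id // part_p'nat ?muln1 ?eqxx //.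
  by rewrite -odd_2'nat.
rewrite (mem_normal_Hall hallP) ?inE //; last first.
  by rewrite -sub_abelian_normal ?subsetT ?zmod_abelian.
apply: (@pnat_dvd _ (2 ^ a.+1)); last by rewrite pnatX pnat_id.
rewrite order_dvdn zmodXgE expnS mulrnA mulr2n -zmodXgE -order_dvdn -ow.
exact: order_dvdG.
Qed.

(** Solves j v = u for the involution u = 2^a w: the power of 2 in [v] completes that of [j] to 2^a,
    and the odd part of [j] fixes u. *)
Lemma mulrn_logn2 (G : finZmodType) (w : G) (a j : nat) :
  #[w]%g = (2 ^ a.+1)%N -> (0 < j)%N -> (logn 2 j <= a)%N ->
  w *+ (2 ^ (a - logn 2 j)) *+ j = w *+ (2 ^ a).
Proof.
move=> ow j0 leja.
have oj : odd (j`_2^')%N by rewrite odd_2'nat part_pnat.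
rewrite -mulrnA -[X in (_ * X)%N](partnC 2%N j0) p_part mulnA -expnD subnK //=.
rewrite -[X in (_ * X)%N]odd_double_half oj mulnDr muln1 -mul2n mulnA -expnSr.
rewrite mulrnDr [X in _ + X]mulrnA -[X in _ + X *+ _]zmodXgE -ow expg_order.
by rewrite zmod1gE mul0rn addr0.
Qed.

Lemma mulrn_odd (G : finZmodType) (u : G) (m : nat) :
  u + u = 0 -> u *+ m = if odd m then u else 0.
Proof.
move=> uu; rewrite -[m in LHS]odd_double_half mulrnDr -mul2n mulrnA mulr2n uu.
by rewrite mul0rn addr0; case: odd.
Qed.

(** Here [z] is the multiple of the representatives' sum by the order of [w], so [M] kills it
    because the order of the group kills everything. *)
Lemma sum_stable_cycle (G : finZmodType) (w : G) (a M m : nat) (S : {set G}) :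
  #[w]%g = (2 ^ a.+1)%N -> #|G| = (2 ^ a.+1 * M)%N ->
  stable <[w]>%G S -> #|S| = (m * 2 ^ a.+1)%N ->
  exists2 z, z *+ M = 0 & \sum_(x in S) x = z + w *+ (2 ^ a) *+ m.
Proof.
move=> ow cG /sum_stable[Y [m' [cS sS]]]; rewrite -orderE ow in cS sS.
move/eqP; rewrite cS eqn_pmul2r ?expn_gt0 // => /eqP <-.
exists (Y *+ 2 ^ a.+1).
  by rewrite -mulrnA -cG -cardsT -zmodXgE expg_cardG ?inE.
by rewrite sS (@sum_cycle_even _ _ (2 ^ a)) // ow expnS mul2n.
Qed.

Lemma sum_symmetricD (G : finZmodType) (S : {set G}) :
  (forall x, x \in S -> - x \in S) -> \sum_(x in S) x + \sum_(x in S) x = 0.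
Proof.
move=> symS; suff {1}-> : \sum_(x in S) x = - \sum_(x in S) x by rewrite addNr.
rewrite -sumrN (reindex_inj (@oppr_inj G)); apply: eq_bigl => x.
by apply/idP/idP => /symS; rewrite ?opprK.
Qed.

(** Symmetry makes twice the sum vanish, so the component [z] is killed by 2 as well as by the odd
    number [M]. *)
Lemma sum_symmetric (G : finZmodType) (w : G) (a M m : nat) (S : {set G}) :
  #[w]%g = (2 ^ a.+1)%N -> #|G| = (2 ^ a.+1 * M)%N -> odd M ->
  stable <[w]>%G S -> (forall x, x \in S -> - x \in S) ->
  #|S| = (m * 2 ^ a.+1)%N -> \sum_(x in S) x = w *+ (2 ^ a) *+ m.
Proof.
move=> ow cG oM stS symS cS.
have [z zM sS] := sum_stable_cycle ow cG stS cS.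
have uu : w *+ 2 ^ a *+ m + w *+ 2 ^ a *+ m = 0.
  rewrite -mulrnDl -mulrnDr addnn -mul2n -expnS -ow.
  by rewrite -[w *+ _]zmodXgE expg_order zmod1gE mul0rn.
have zz : z + z = 0.
  by rewrite -[LHS]addr0 -uu addrACA -sS sum_symmetricD.
by move: zM; rewrite (mulrn_odd _ zz) oM sS => ->; rewrite add0r.
Qed.

Lemma card_subsets_sum_cyclic (G : finZmodType) (w : G) (a M k : nat) :
  #[w]%g = (2 ^ a.+1)%N -> #|G| = (2 ^ a.+1 * M)%N -> odd M ->
  (0 < k < #|G|)%N ->
  #|subsets_sum k (0 : G)| = #|subsets_sum k (w *+ (2 ^ a))| <->
  (logn 2 k <= a)%N.
Proof.
move=> ow cG oM /andP[k0 ltkG]; set u := w *+ _.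
have uu : u + u = 0.
  by rewrite -mulrnDr addnn -mul2n -expnS -ow -zmodXgE expg_order.
have u0 : u != 0.
  by rewrite /u -zmodXgE -zmod1gE -order_dvdn ow dvdn_Pexp2l // ltnn.
have cW : #|<[w]>%G| = (2 ^ a.+1)%N by rewrite -orderE ow.
split=> [eq_card | leka]; last first.
  have v_k := mulrn_logn2 ow k0 leka.
  apply/eqP; rewrite eqn_leq; apply/andP; split.
    have := leq_subsets_sum_shift k 0 (w *+ 2 ^ (a - logn 2 k)).
    by rewrite v_k add0r.
  have := leq_subsets_sum_shift k u (w *+ 2 ^ (a - logn 2 k)).
  by rewrite v_k uu.
(* Otherwise k = m 2^(a+1). The unstable sets contribute equally to both counts, so the stable ones
   decide. *)
rewrite leqNgt -pfactor_dvdn //; apply/negP => /dvdnP[m km].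
pose W := <[w]>%G.
have eq_unstable : #|subsets_sum k (0 : G) :&: unstable_sets W|
                 = #|subsets_sum k u :&: unstable_sets W|.
  have fW j : (0 < j < #|W|)%N -> w *+ 2 ^ (a - logn 2 j) \in W /\
      w *+ 2 ^ (a - logn 2 j) *+ j = u.
    rewrite cW => /andP[j0 ltj]; split; first by rewrite -zmodXgE mem_cycle.
    (* A positive [j] below 2^(a+1) has 2-adic valuation at most [a]. *)
    apply: mulrn_logn2 => //; rewrite leqNgt -pfactor_dvdn //.
    by apply/negP => /(dvdn_leq j0); rewrite leqNgt ltj.
  apply/eqP; rewrite eqn_leq; apply/andP; split.
    by have := leq_card_unstable k 0 fW; rewrite add0r.
  by have := leq_card_unstable k u fW; rewrite uu.
move: eq_card; rewrite -(cardsID (unstable_sets W)) eq_unstable.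
rewrite -[RHS](cardsID (unstable_sets W)) => /addnI.
(* Such a stable set would force [z = u], but the odd [M] kills [z] and not [u]. *)
have no_stable : #|subsets_sum k (u *+ m.+1) :\: unstable_sets W| = 0%N.
  apply/eqP; rewrite cards_eq0; apply/eqP/setP => S; rewrite in_set0 in_setD.
  apply/negP => /andP[/unstable_setsPn stS].
  rewrite in_subsets_sum km => /andP[/eqP cS /eqP sS].
  have [z zM] := sum_stable_cycle ow cG stS cS.
  rewrite sS mulrSr addrC => /addIr zu.
  by move: zM; rewrite -zu (mulrn_odd _ uu) oM => /eqP; apply/negP.
have some_stable : #|subsets_sum k (u *+ m) :\: unstable_sets W| != 0%N.
  have W2 := odd_index_cycle ow cG oM.
  have ltmM : (m < M)%N by move: ltkG; rewrite km cG mulnC ltn_pmul2l ?expn_gt0.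
  suff [S [stS symS cS]] : exists S : {set G},
      [/\ stable W S, forall x, x \in S -> - x \in S & #|S| = k].
    rewrite cards_eq0; apply/set0Pn; exists S.
    rewrite in_setD in_subsets_sum cS eqxx.
    rewrite (sum_symmetric ow cG oM stS symS (etrans cS km)) eqxx /= andbT.
    exact/unstable_setsPn.
  (* The symmetric union has an odd number of cosets: [m] itself for odd [m], and [m + 1] for even
     [m], when [W] is taken out again. *)
  have [|S [stS symS sWS]] := @exists_symmetric_stable _ W m./2 W2.
    rewrite cW cG mulnC leq_pmul2l ?expn_gt0 //; move: ltmM.
    rewrite -{1}[m]odd_double_half; case: (odd m); first exact: ltnW.
    by [].
  rewrite cW; have := odd_double_half m; case: (odd m) => /= em cS.
    by exists S; split; rewrite // cS -add1n em km.
  exists (S :\: W); split.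
  - by apply: stableD => // x y Wx Wy; rewrite groupD.
  - by move=> x /setDP[/symS Sx nWx]; rewrite in_setD groupN nWx.
  - rewrite cardsD (setIidPr sWS) cS cW mulSn addnC addnK.
    by rewrite -[m./2.*2]add0n em km.
(* The parity of [m] decides which of [u *+ m] and [u *+ m.+1] is 0 and which is [u]. *)
move: no_stable some_stable; rewrite !(mulrn_odd _ uu) /=.
by case: (odd m) => /= c0 c1 c01; move: c1; rewrite ?c01 ?c0 // -c01 c0.
Qed.

(** * Invariants of the direct sum of cyclic groups *)

Lemma dvdn_chain (r : nat) (n : nat -> nat) :
  (forall i, (1 <= i < r)%N -> (n i %| n i.+1)%N) ->
  forall i j, (1 <= i)%N -> (i <= j <= r)%N -> (n i %| n j)%N.
Proof.
move=> dvn i j i0; elim: j => [|j IHj]; first by case: i i0.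
case/andP=> leij ltjr; move: leij; rewrite leq_eqVlt => /orP[/eqP -> //|].
rewrite ltnS => leij; apply: (dvdn_trans (IHj _)); first by rewrite leij ltnW.
by apply: dvn; rewrite (leq_trans i0).
Qed.

Lemma card_cyclic_sum (r : nat) (n : nat -> nat) :
  (forall i, (1 <= i <= r)%N -> (1 < n i)%N) ->
  #|cyclic_sum r n| = (\prod_(i < r) n i.+1)%N.
Proof.
move=> n1; rewrite card_dep_ffun foldrE big_map big_enum /=.
by apply: eq_bigr => i _; rewrite card_ord Zp_cast // n1 // ltn_ord.
Qed.

Lemma exponent_cyclic_sum (r : nat) (n : nat -> nat) :
  (forall i, (1 <= i <= r.+1)%N -> (1 < n i)%N) ->
  (forall i, (1 <= i < r.+1)%N -> (n i %| n i.+1)%N) ->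
  (exponent [set: cyclic_sum r.+1 n] %| n r.+1)%N.
Proof.
move=> n1 dvn; apply/exponentP => x _; apply/ffunP => i.
have -> : (x ^+ n r.+1)%g i = (x i ^+ n r.+1)%g.
  elim: (n r.+1) => [|m IHm]; rewrite ?expg0 ?oneg_ffun //.
  by rewrite !expgS mulg_ffun IHm.
rewrite oneg_ffun; apply/eqP; rewrite -order_dvdn.
apply: dvdn_trans (order_dvdG (in_setT _)) _; rewrite cardsT card_ord Zp_cast.
  by apply: (dvdn_chain dvn) => //; rewrite ltn_ord /=.
by rewrite n1 // ltn_ord.
Qed.

Lemma exists_order_cyclic_sum (r : nat) (n : nat -> nat) :
  (1 < n r.+1)%N -> exists e : cyclic_sum r.+1 n, #[e]%g = n r.+1.
Proof.
move=> n1; exists (dfung1 (i := ord_max) (Zp1 : 'Z_(n (@ord_max r).+1))).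
by rewrite (order_injm (injm_dfung1 _ _)) ?inE // order_Zp1 Zp_cast.
Qed.

(** Collects what is used of the isomorphism: the order, a bound on the exponent, and an element
    attaining it. *)
Lemma isog_cyclic_sum (G : finZmodType) (r : nat) (n : nat -> nat) :
  (forall i, (1 <= i <= r.+1)%N -> (1 < n i)%N) ->
  (forall i, (1 <= i < r.+1)%N -> (n i %| n i.+1)%N) ->
  [set: G] \isog [set: cyclic_sum r.+1 n] ->
  [/\ #|G| = (n r.+1 * \prod_(i < r) n i.+1)%N,
      forall x : G, x *+ n r.+1 = 0
    & exists e : G, #[e]%g = n r.+1].
Proof.
move=> n1 dvn isoG; split.
- rewrite -cardsT (card_isog isoG) cardsT card_cyclic_sum //.
  by rewrite big_ord_recr mulnC.
- move=> x; rewrite -zmodXgE; apply: (exponentP _ x (in_setT x)).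
  by rewrite (exponent_isog isoG) exponent_cyclic_sum.
have [e oe] := exists_order_cyclic_sum (n1 r.+1 (leqnn _)).
have /isogP[f injf imf] : [set: cyclic_sum r.+1 n] \isog [set: G].
  by rewrite isog_sym.
by exists (f e); rewrite order_injm // inE.
Qed.

(** * The sum of all elements, and the equivalence *)

(** The group is a union of [M] cosets of [<[e]>]; the representatives contribute nothing since the
    order of [e] kills the group. *)
Lemma sum_finZmod (G : finZmodType) (e : G) (h M : nat) :
  #[e]%g = h.*2 -> #|G| = (h.*2 * M)%N -> (forall x : G, x *+ h.*2 = 0) ->
  \sum_(x : G) x = e *+ h *+ M.
Proof.
move=> oe cG xn.
have st : stable <[e]>%G [set: G] by move=> x y; rewrite !in_setT.
have [Y [m [cS]]] := sum_stable st; rewrite -orderE oe xn add0r in cS *.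
rewrite (eq_bigl _ _ (@in_setT G)) (sum_cycle_even oe) => ->.
congr (_ *+ _); apply/eqP.
have : (0 < h.*2 * M)%N by rewrite -cG; apply/card_gt0P; exists 0.
rewrite muln_gt0 => /andP[h0 _]; rewrite -(eqn_pmul2r h0) -cS cardsT cG mulnC.
by [].
Qed.

Local Close Scope ring_scope.

Theorem theorem1p2 (G : finZmodType) (r : nat) (n : nat -> nat) (k : nat)
  (hr : 1 <= r)
  (hn : forall i : nat, 1 <= i <= r -> 1 < n i)
  (hdvd : forall i : nat, 1 <= i < r -> n i %| n i.+1)
  (hG : [set: G] \isog [set: cyclic_sum r n])
  (hk : 1 <= k <= #|G| - 1) :
  #|zero_sum_subsets G k| = #|zero_sum_subsets G (#|G| - k)| <->
  odd #|G| \/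
  (2 <= r /\ 2 %| n (r - 1)) \/
  logn 2 k < logn 2 (n r).
Proof.
(* From here [n r.+1] is the largest modulus, and [n r] the one before it if [r] is positive. *)
case: r hr hn hdvd hG => // r _ n1 dvn isoG.
have [cG xn [e oe]] := isog_cyclic_sum n1 dvn isoG.
have G0 : (0 < #|G|)%N by apply/card_gt0P; exists 0%R.
have /andP[k0 ltkG] : (0 < k < #|G|)%N.
  by case/andP: hk => ->; rewrite leq_subRL // add1n.
have -> : zero_sum_subsets G k = subsets_sum k 0%R by [].
have -> : zero_sum_subsets G (#|G| - k) = subsets_sum (#|G| - k) 0%R by [].
rewrite card_subsets_sumC ?subr0 ?(ltnW ltkG) //.
have [oG | eG] := boolP (odd #|G|).
  suff -> : (\sum_(g : G) g = 0)%R by split=> // _; left.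
  have ss := sum_symmetricD (fun (x : G) _ => in_setT (- x)%R).
  rewrite !(eq_bigl _ _ (@in_setT G)) in ss.
  (* The total is killed by 2 and by the odd order of the group. *)
  have := mulrn_odd #|G| ss; rewrite oG => <-.
  by rewrite -cardsT -zmodXgE expg_cardG ?inE.
have en : ~~ odd (n r.+1).
  apply: contra eG => on; rewrite cG oddM on /=.
  elim/big_ind: _ => // [x y ox oy | i _]; first by rewrite oddM ox.
  have /dvdnP[c nE] : n i.+1 %| n r.+1.
    by apply: (dvdn_chain dvn) => //=; rewrite leqnn andbT ltnS ltnW.
  by move: on; rewrite nE oddM => /andP[].
have nh : n r.+1 = (n r.+1)./2.*2 by rewrite -[LHS]odd_double_half (negPf en).
(* The cofactor of the largest modulus is even exactly under condition (2): by divisibility, an even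
   modulus makes all later ones even. *)
have [oM | eM] := boolP (odd (\prod_(i < r) n i.+1)); last first.
  have -> : (\sum_(g : G) g = 0)%R.
    rewrite nh in oe cG xn; rewrite (sum_finZmod oe cG xn).
    rewrite -[X in (_ *+ X)%R]odd_double_half.
    rewrite (negPf eM) add0n -mul2n -mulrnA mulnA muln2 mulrnA.
    by rewrite xn mul0rn.
  split=> // _; right; left; rewrite subn1 /= dvdn2.
  have [r0 | r_gt0] := posnP r; first by move: eM; rewrite r0 big_ord0.
  split=> //; apply: contra eM => on.
  elim/big_ind: _ => // [x y ox oy | i _]; first by rewrite oddM ox.
  have /dvdnP[c nE] : n i.+1 %| n r.
    by apply: (dvdn_chain dvn) => //=; rewrite ltn_ord leqnSn.
  by move: on; rewrite nE oddM => /andP[].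
have n0 : 0 < n r.+1 by rewrite ltnW // n1 /=.
(* Multiplying [e] by the odd part of its order gives a generator of the Sylow 2-subgroup. *)
pose c := ((n r.+1)`_2^')%N; have oc : odd c by rewrite odd_2'nat part_pnat.
have [a la] : exists a, logn 2 (n r.+1) = a.+1.
  exists (logn 2 (n r.+1)).-1; rewrite prednK // -pfactor_dvdn // expn1 dvdn2.
  exact: en.
have nE : n r.+1 = 2 ^ a.+1 * c by rewrite -[LHS](partnC 2%N n0) p_part la.
have ow : #[(e *+ c)%R]%g = 2 ^ a.+1.
  by rewrite -zmodXgE orderXdiv oe nE ?dvdn_mull // mulnK // odd_gt0.
have cG' : #|G| = 2 ^ a.+1 * (c * \prod_(i < r) n i.+1) by rewrite cG nE mulnA.
have oM' : odd (c * \prod_(i < r) n i.+1) by rewrite oddM oc.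
(* The whole group is a symmetric union of an odd number of cosets of that subgroup. *)
have sG : (\sum_(g : G) g = e *+ c *+ 2 ^ a)%R.
  rewrite -(eq_bigl _ _ (@in_setT G)).
  rewrite (sum_symmetric (m := c * \prod_(i < r) n i.+1) ow cG' oM').
  - rewrite mulrn_odd ?oM' // -mulrnDr addnn -mul2n -expnS -ow.
    by rewrite -[LHS]zmodXgE expg_order.
  - by move=> x y; rewrite !in_setT.
  - by move=> x; rewrite !in_setT.
  - by rewrite cardsT cG' mulnC.
have [eq_k k_eq] :
    #|subsets_sum k (0%R : G)| = #|subsets_sum k (e *+ c *+ 2 ^ a)%R| <->
    logn 2 k <= a.
  by apply: (card_subsets_sum_cyclic ow cG' oM'); rewrite k0.
rewrite sG la ltnS; split=> [/eq_k leka | ]; first by do 2 right.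
(* Condition (2) contradicts [oM], whose product has [n r] as its last factor. *)
case=> // -[[]|/k_eq //]; rewrite subn1 /= dvdn2.
by case: (r) oM => // r'; rewrite big_ord_recr oddM /= => /andP[_ ->].
Qed.
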